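(* Let $k$ be a field and let $I\subseteq k[x_0,\dots,x_n]$ be a nonzero, proper, homogeneous radical ideal with big height $h$ such that $\rho(I)>\rho_a(I)$. Suppose that $$\rho_a(I)=\frac{hr_1-h}{r_1}$$ for some integer $r_1>0$. Then $\rho(I)$ can be computed by taking the maximum of finitely many ratios $\frac{s}{r}$ with $I^{(s)}\nsubseteq I^r$; that is, there is a finite nonempty set $F$ of pairs $(s,r)$ of positive integers with $I^{(s)}\nsubseteq I^r$ for every $(s,r)\in F$ such that $\rho(I)=\max_{(s,r)\in F}\frac{s}{r}$.
   Context: For a radical ideal $I$, the $m$-th symbolic power is $I^{(m)}=\bigcap_{\mathfrak p\in \mathrm{Ass}(I)}\mathfrak p^m$. The big height of an ideal is the maximum of the heights of its associated primes. For a nonzero, proper homogeneous ideal $I$ the resurgence is $\rho(I)=\sup\{m/r : I^{(m)}\nsubseteq I^r\}$ and the asymptotic resurgence is $\rho_a(I)=\sup\{m/r : I^{(mt)}\nsubseteq I^{rt}\text{ for all }t\gg0\}$, where $m,r$ range over positive integers. *)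

(* Defs.v *)
(* multinomials has to be imported before mathcomp-analysis: the two declare
   clashing notation levels, and only this order is accepted. *)
From HB Require Import structures.
From mathcomp Require Import all_boot all_order all_algebra finmap.
From mathcomp Require Import mpoly.
From mathcomp Require Import boolp classical_sets reals constructive_ereal ereal.

Set Implicit Arguments.
Unset Strict Implicit.
Unset Printing Implicit Defensive.

Import Order.TTheory GRing.Theory Num.Theory.

Local Open Scope classical_set_scope.
Local Open Scope ring_scope.

(* The ideals of ring_quotient ([idealr_closed]) are proper; here the unit
   ideal has to be allowed, e.g. as the zeroth power of an ideal. *)
Definition is_ideal (A : comNzRingType) (I : set A) : Prop :=
  I 0 /\ forall a x y : A, I x -> I y -> I (a * x + y).

Definition is_prime_ideal (A : comNzRingType) (P : set A) : Prop :=
  [/\ is_ideal P, ~ P 1 & forall x y : A, P (x * y) -> P x \/ P y].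

Definition is_radical_ideal (A : comNzRingType) (I : set A) : Prop :=
  is_ideal I /\ forall (x : A) (m : nat), I (x ^+ m) -> I x.

Lemma idealr_closedE (A : comNzRingType) (I : set A) :
  idealr_closed (mem I) <-> is_ideal I /\ ~ I 1.
Proof.
split=> [[I0 I1 IM]|[[I0 IM] I1]].
  split; last by move=> J1; case/negP: I1; exact: mem_set.
  split=> [|a x y Ix Iy]; first exact: set_mem I0.
  by apply: set_mem; apply: IM; exact: mem_set.
split; first exact: mem_set.
  by apply/negP => J1; apply: I1; exact: set_mem J1.
by move=> a x y Ix Iy; apply: mem_set; apply: IM; [exact: set_mem Ix|exact: set_mem Iy].
Qed.

Lemma prime_idealr_closedE (A : comNzRingType) (P : set A) :
  idealr_closed (mem P) /\ prime_idealr_closed (mem P) <-> is_prime_ideal P.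
Proof.
split=> [[/idealr_closedE[iP P1] Pp]|[iP P1 Pp]].
  split=> // x y Pxy.
  by have /orP[Px|Py] := Pp x y (mem_set Pxy);
    [left; exact: set_mem Px|right; exact: set_mem Py].
split; first exact/idealr_closedE.
move=> x y Pxy; apply/orP.
by have [Px|Py] := Pp x y (set_mem Pxy); [left|right]; exact: mem_set.
Qed.

Definition ideal_gen (A : comNzRingType) (S : set A) : set A :=
  smallest (@is_ideal A) S.

Definition ideal_mul (A : comNzRingType) (I J : set A) : set A :=
  ideal_gen [set x * y | x in I & y in J].

Definition ideal_pow (A : comNzRingType) (I : set A) (m : nat) : set A :=
  iter m (ideal_mul I) setT.

(* The associated primes of A / I: the primes of the form (I : f). *)
Definition Ass (A : comNzRingType) (I : set A) : set (set A) :=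
  [set P | is_prime_ideal P /\ exists f : A, P = [set x | I (x * f)]].

(* P is the top of a chain c 0 < c 1 < ... < c l = P of prime ideals. *)
Definition prime_chain (A : comNzRingType) (P : set A) (l : nat) : Prop :=
  exists c : nat -> set A,
    [/\ c l = P,
        forall i : nat, (i <= l)%N -> is_prime_ideal (c i)
      & forall i : nat, (i < l)%N -> c i `<` c i.+1].

Definition is_prime_height (A : comNzRingType) (P : set A) (h : nat) : Prop :=
  prime_chain P h /\ forall l : nat, prime_chain P l -> (l <= h)%N.

Definition is_big_height (A : comNzRingType) (I : set A) (h : nat) : Prop :=
  (exists2 P, Ass I P & is_prime_height P h) /\
  forall P, Ass I P -> exists2 h' : nat, is_prime_height P h' & (h' <= h)%N.

(* For a radical ideal I. The P ^ m are ordinary powers, not localized at P. *)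
Definition symbolic_pow (A : comNzRingType) (I : set A) (m : nat) : set A :=
  \bigcap_(P in Ass I) ideal_pow P m.

(* The suprema are taken in the extended reals, so that no boundedness has to
   be assumed. *)
Definition resurgence (R : realType) (A : comNzRingType) (I : set A) : \bar R :=
  ereal_sup [set z | exists m r : nat,
    [/\ (0 < m)%N, (0 < r)%N,
        ~ (symbolic_pow I m `<=` ideal_pow I r)
      & z = (m%:R / r%:R)%:E]].

Definition asymptotic_resurgence (R : realType) (A : comNzRingType)
    (I : set A) : \bar R :=
  ereal_sup [set z | exists m r : nat,
    [/\ (0 < m)%N, (0 < r)%N,
        exists t0 : nat, forall t : nat, (t0 <= t)%N ->
          ~ (symbolic_pow I (m * t)%N `<=` ideal_pow I (r * t)%N)
      & z = (m%:R / r%:R)%:E]].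

(* I is an ideal generated by homogeneous polynomials. *)
Definition is_homogeneous_ideal (k : fieldType) (n : nat)
    (I : set {mpoly k[n]}) : Prop :=
  I = ideal_gen [set p | I p /\ exists d : nat, p \is d.-homog].

(* Main.v *)
(* It suffices to show that the supremum defining rho is attained. By definition
   of rho_a there are, for p/q slightly above rho_a, infinitely many t with
   I^(pt) in I^(qt). If f lies in I^(s) with s/r bounded below away from rho_a,
   comparing a large power f^N with such a t gives f^N in I^(N (r + L)) as soon
   as r is large, where L is any constant. A weak form of the Briancon-Skoda
   theorem, for L the number of generators of I, then yields f in I^r; hence only
   finitely many noncontainments have a large ratio s/r.

   In characteristic p the Briancon-Skoda statement follows by pigeonhole and a
   splitting of the Frobenius. The general case reduces to it: if f is not in I^r,
   then, I^r being homogeneous, a linear functional depending on finitely many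
   coefficients vanishes on I^r but not at f, so that the hypothesis and the
   failure of the conclusion are polynomial identities in finitely many elements
   of k, and can be specialized to an algebraically closed field of positive
   characteristic. *)

Require Import Defs.
From HB Require Import structures.
From mathcomp Require Import all_boot all_order all_algebra finmap.
From mathcomp Require Import closed_field.
From mathcomp Require Import mpoly.
From mathcomp Require Import boolp classical_sets reals constructive_ereal ereal.
From mathcomp Require Import zify lra.

Set Implicit Arguments.
Unset Strict Implicit.
Unset Printing Implicit Defensive.

Import Order.TTheory GRing.Theory Num.Theory.

Local Open Scope classical_set_scope.
Local Open Scope ring_scope.

(** * Ideals *)

Section Ideals.
Variable A : comNzRingType.
Implicit Types (I J : set A) (S : set A).

Lemma idealD I x y : is_ideal I -> I x -> I y -> I (x + y).
Proof. by move=> [_ IM] Ix Iy; have := IM 1 _ _ Ix Iy; rewrite mul1r. Qed.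

Lemma idealM I a x : is_ideal I -> I x -> I (a * x).
Proof. by move=> [I0 IM] Ix; have := IM a _ _ Ix I0; rewrite addr0. Qed.

Lemma ideal_sum I (T : Type) (s : seq T) (P : pred T) (F : T -> A) :
  is_ideal I -> (forall i, P i -> I (F i)) -> I (\sum_(i <- s | P i) F i).
Proof.
move=> iI IF; elim/big_ind: _ => [|x y Ix Iy|//]; first by case: iI.
exact: idealD.
Qed.

Lemma ideal_gen_ideal S : is_ideal (ideal_gen S).
Proof.
split=> [J [[J0 _] _] //|a x y Jx Jy J [iJ SJ]].
by case: (iJ) => _; apply; [exact: Jx|exact: Jy].
Qed.

Lemma sub_ideal_gen S : S `<=` ideal_gen S.
Proof. by move=> x Sx J [_]; apply. Qed.

Lemma ideal_gen_min S I : is_ideal I -> S `<=` I -> ideal_gen S `<=` I.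
Proof. by move=> iI SI x; apply. Qed.

Lemma ideal_pow_ideal I m : is_ideal (ideal_pow I m).
Proof. by case: m => [|m] //; exact: ideal_gen_ideal. Qed.

Lemma ideal_powS_sub I m : ideal_pow I m.+1 `<=` ideal_pow I m.
Proof.
apply: ideal_gen_min; first exact: ideal_pow_ideal.
by move=> _ [x _ [y Iy <-]]; apply: idealM => //; exact: ideal_pow_ideal.
Qed.

Lemma ideal_pow_sub I m m' : (m <= m')%N -> ideal_pow I m' `<=` ideal_pow I m.
Proof.
move=> /subnK <-; elim: (m' - m)%N => [//|d IH].
by apply: subset_trans IH; exact: ideal_powS_sub.
Qed.

Lemma ideal_powD I m m' x y :
  ideal_pow I m x -> ideal_pow I m' y -> ideal_pow I (m + m') (x * y).
Proof.
move=> + Iy; elim: m x => [|m IH] x.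
  by move=> _; apply: idealM => //; exact: ideal_pow_ideal.
apply: (@ideal_gen_min _ [set x | ideal_pow I (m.+1 + m') (x * y)]).
  have [P0 PM] := ideal_pow_ideal I (m.+1 + m').
  by split=> [|a u v Iu Iv] /=; rewrite ?mul0r// mulrDl -mulrA; exact: PM.
move=> _ [u Iu [v Iv <-]]; rewrite /= -mulrA.
by refine (sub_ideal_gen _); exists u => //; exists (v * y) => //; exact: IH.
Qed.

Lemma ideal_powX I m x t : ideal_pow I m x -> ideal_pow I (m * t) (x ^+ t).
Proof.
move=> Ix; elim: t => [|t IH]; first by rewrite muln0.
by rewrite mulnS exprS; exact: ideal_powD.
Qed.

Lemma mem_ideal_gen_range (T : Type) (g : T -> A) t : ideal_gen (range g) (g t).
Proof. by move=> J [_]; apply; exists t. Qed.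

Lemma ideal_gen_range (T : Type) (g : T -> A) x :
  ideal_gen (range g) x <-> exists s : seq (A * T), x = \sum_(c <- s) c.1 * g c.2.
Proof.
split=> [|[s ->]]; last first.
  refine (ideal_sum _ (ideal_gen_ideal _) _) => c _.
  by refine (idealM _ (ideal_gen_ideal _) _); exact: mem_ideal_gen_range.
apply: (@ideal_gen_min _ [set x | exists s : seq (A * T), x = \sum_(c <- s) c.1 * g c.2]).
  split=> [|a _ _ [s ->] [s' ->]]; first by exists [::]; rewrite big_nil.
  exists ([seq (a * c.1, c.2) | c <- s] ++ s'); rewrite big_cat big_map /= mulr_sumr.
  by congr (_ + _); apply: eq_bigr => c _; rewrite mulrA.
by move=> _ [t _ <-]; exists [:: (1, t)]; rewrite big_seq1 mul1r.
Qed.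

Lemma ideal_pow_gen_range (T : Type) (g : T -> A) m :
  ideal_pow (ideal_gen (range g)) m =
  ideal_gen (range (fun w : m.-tuple T => \prod_(i <- w) g i)).
Proof.
elim: m => [|m IH].
  rewrite eqEsubset; split=> // x _; rewrite -[x]mulr1.
  refine (idealM _ (ideal_gen_ideal _) _).
  by have := @mem_ideal_gen_range _ (fun w : 0.-tuple T => \prod_(i <- w) g i) [tuple];
    rewrite big_nil.
rewrite eqEsubset; split.
  apply: ideal_gen_min; first exact: ideal_gen_ideal.
  move=> _ [x /ideal_gen_range[s xE] [y Iy <-]].
  have {Iy} : ideal_pow (ideal_gen (range g)) m y by [].
  rewrite IH => /ideal_gen_range[s' ->].
  rewrite {}xE.
  rewrite mulr_suml; refine (ideal_sum _ (ideal_gen_ideal _) _) => c _.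
  rewrite mulr_sumr; refine (ideal_sum _ (ideal_gen_ideal _) _) => c' _.
  rewrite mulrACA; refine (idealM _ (ideal_gen_ideal _) _).
  have := @mem_ideal_gen_range _ (fun w : m.+1.-tuple T => \prod_(i <- w) g i)
            [tuple of c.2 :: c'.2].
  by rewrite big_cons.
apply: ideal_gen_min; first exact: ideal_pow_ideal.
move=> _ [w _ <-]; case/tupleP: w => i w; rewrite big_cons.
refine (sub_ideal_gen _); exists (g i); first exact: mem_ideal_gen_range.
exists (\prod_(j <- w) g j) => //.
suff : ideal_pow (ideal_gen (range g)) m (\prod_(j <- w) g j) by []; rewrite IH.
exact: (@mem_ideal_gen_range _ _ w).
Qed.

Lemma ideal_powP (T : Type) (g : T -> A) m x :
  ideal_pow (ideal_gen (range g)) m x <->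
  exists s : seq (A * m.-tuple T), x = \sum_(c <- s) c.1 * \prod_(i <- c.2) g i.
Proof. by rewrite ideal_pow_gen_range; exact: ideal_gen_range. Qed.

Lemma symbolic_pow_sub I m m' :
  (m <= m')%N -> symbolic_pow I m' `<=` symbolic_pow I m.
Proof. by move=> mm' x Ix P AP; apply: ideal_pow_sub mm' _ (Ix P AP). Qed.

Lemma symbolic_powX I m x t : symbolic_pow I m x -> symbolic_pow I (m * t) (x ^+ t).
Proof. by move=> Ix P AP; apply: ideal_powX (Ix P AP). Qed.

(* T is a q-th root composed with a splitting of the Frobenius: it undoes
   q-th powers, and by pigeonhole it maps high powers of the ideal into low ones. *)
Lemma frobenius_split_pow (T : A -> A) (q l : nat) (g : 'I_l -> A) (r M : nat) (x : A) :
  (0 < q)%N -> {morph T : x y / x + y} -> (forall a u, T (a * u ^+ q) = T a * u) ->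
  (q * r + l * q < M + q)%N ->
  ideal_pow (ideal_gen (range g)) M x -> ideal_pow (ideal_gen (range g)) r (T x).
Proof.
move=> q0 TD TM qM /ideal_powP[s ->].
have T0 : T 0 = 0.
  by have := TM 0 0; rewrite mulr0 expr0n (gtn_eqF q0) mulr0.
have iP := ideal_pow_ideal (ideal_gen (range g)) r.
rewrite (big_morph T TD T0); refine (ideal_sum _ iP _) => -[a w] _ /=.
pose c j := count_mem j w.
have -> : \prod_(i <- w) g i = \prod_j g j ^+ c j.
  rewrite -prodr_undup_exp_count big_uniq ?undup_uniq// [RHS](bigID (mem (undup w)))/=.
  rewrite [X in _ = _ * X]big1 ?mulr1// => j; rewrite mem_undup => jw.
  by rewrite /c (count_memPn jw).
(* Pigeonhole: rounding each exponent down to a multiple of [q] loses at most [q - 1], so the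
   product contains the [q]-th power of a product of [d] generators, and the bound on [M] forces
   [r <= d]. *)
pose d := (\sum_j c j %/ q)%N.
have dr : (r <= d)%N.
  have cM : (\sum_j c j = M)%N.
    rewrite -[RHS](size_tuple w) -sum1_size [RHS](partition_big (fun i => i) xpredT)//=.
    by apply: eq_bigr => j _; rewrite /c -sum1_count.
  have : (M <= q * d + l * q.-1)%N.
    have -> : (l * q.-1 = \sum_(j < l) q.-1)%N by rewrite sum_nat_const card_ord.
    rewrite -cM /d big_distrr -big_split/=.
    apply: leq_sum => j _; rewrite {1}(divn_eq (c j) q) mulnC leq_add2l.
    by rewrite -ltnS prednK// ltn_mod.
  have := leq_mul (leqnn l) (leq_pred q).
  case: (leqP r d) => // dr.
  have : (q * d.+1 <= q * r)%N by rewrite leq_mul2l dr orbT.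
  rewrite mulnS; lia.
apply: (ideal_pow_sub dr); have -> : \prod_j g j ^+ c j =
    \prod_j g j ^+ (c j %% q) * (\prod_j g j ^+ (c j %/ q)) ^+ q.
  rewrite -prodrXl -big_split/=; apply: eq_bigr => j _.
  by rewrite -exprM -exprD addnC -divn_eq.
rewrite mulrA TM; refine (idealM _ (ideal_pow_ideal _ _) _).
rewrite /d; elim/big_rec2: _ => // j m y _ Iy.
apply: ideal_powD => //; rewrite -[X in ideal_pow _ X]mul1n; apply: ideal_powX.
rewrite -[g j]mulr1; refine (sub_ideal_gen _); exists (g j); last by exists 1.
exact: mem_ideal_gen_range.
Qed.

(* The hypothesis puts [f ^+ q] in I to the power q * (r + l) minus a constant. *)
Lemma split_briancon_skoda (l : nat) (g : 'I_l -> A) (r N : nat) (f : A) :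
  (forall Q, exists (q : nat) (T : A -> A),
    [/\ (Q <= q)%N, {morph T : x y / x + y}, T 1 = 1
      & forall a u, T (a * u ^+ q) = T a * u]) ->
  (0 < N)%N -> ideal_pow (ideal_gen (range g)) (N * (r + l)) (f ^+ N) ->
  ideal_pow (ideal_gen (range g)) r f.
Proof.
move=> split N0 fN.
(* Rounding [q] down to a multiple of [N] costs at most [N * (r + l)] in the exponent; [q] is taken
   larger than this. *)
have [q [T [qN TD T1 TM]]] := split (N * (r + l)).+1.
have <- : T (f ^+ q) = f by rewrite -[f ^+ q]mul1r TM T1 mul1r.
apply: (@frobenius_split_pow T q l g r (N * (r + l) * (q %/ N))) => //; first by lia.
  have := ltn_ceil q N0; rewrite mulnAC => qlt.
  have := leq_mul qlt (leqnn (r + l)); lia.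
have -> : f ^+ q = f ^+ (q %% N) * (f ^+ N) ^+ (q %/ N).
  by rewrite -exprM -exprD addnC mulnC -divn_eq.
exact: (idealM _ (ideal_pow_ideal _ _) (ideal_powX _ fN)).
Qed.

End Ideals.

(** * Splitting of the Frobenius *)

Section FrobeniusSplitting.
Variables (F : closedFieldType) (p : nat) (n : nat).
Hypothesis pcharF : p \in [pchar F].

Let p_gt0 : (0 < p)%N.
Proof. by rewrite prime_gt0// (pcharf_prime pcharF). Qed.

Let root_exists (c : F) : exists d, d ^+ p == c.
Proof.
have [d /=] := @solve_monicpoly F p (fun i => if i == 0%N then c else 0) p_gt0.
rewrite (bigD1 (Ordinal p_gt0))//= expr0 mulr1 big1 ?addr0 => [dE|i]; first by exists d; apply/eqP.
by rewrite -val_eqE /= => /negbTE ->; rewrite mul0r.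
Qed.

Definition proot (c : F) := xchoose (root_exists c).

Lemma prootK c : proot c ^+ p = c.
Proof. exact/eqP/(xchooseP (root_exists c)). Qed.

Lemma expp_inj : injective (fun c : F => c ^+ p).
Proof. by move=> c d /(fmorph_inj (pFrobenius_aut pcharF)). Qed.

Lemma prootD c d : proot (c + d) = proot c + proot d.
Proof.
apply: expp_inj; rewrite /= prootK -(pFrobenius_autE pcharF) rmorphD/=.
by rewrite !pFrobenius_autE !prootK.
Qed.

Lemma prootM c d : proot (c ^+ p * d) = c * proot d.
Proof. by apply: expp_inj; rewrite /= exprMn !prootK. Qed.

Lemma proot0 : proot 0 = 0.
Proof. by have := prootM 0 0; rewrite mulr0 mul0r. Qed.

(** Projection onto the monomials with all exponents divisible by [p], followed by the inverse of
    Frobenius. The bound [msize a] cuts off nothing, since [mdeg m <= mdeg (m *+ p)]. *)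
Definition mpoly_proot (a : {mpoly F[n]}) : {mpoly F[n]} :=
  \sum_(m : 'X_{1..n < msize a}) proot a@_(m *+ p)%MM *: 'X_[m].

Lemma mcoeff_mpoly_proot a m : (mpoly_proot a)@_m = proot a@_(m *+ p)%MM.
Proof.
rewrite /mpoly_proot; have [ma|am] := ltnP (mdeg m) (msize a).
  by rewrite (mcoeff_mpoly (fun m => proot a@_(m *+ p)%MM) ma).
rewrite raddf_sum/= big1 => [|i _].
  rewrite memN_msupp_eq0 ?proot0//; apply: contraTN am => /msize_mdeg_lt.
  rewrite mdegMn -ltnNge; apply: leq_ltn_trans.
  by rewrite leq_pmulr.
rewrite mcoeffZ mcoeffX; case: eqP => [im|_]; last by rewrite mulr0.
by move: am; rewrite -im leqNgt bmdeg.
Qed.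

Lemma mpoly_prootD : {morph mpoly_proot : a b / a + b}.
Proof.
by move=> a b; apply/mpolyP => m; rewrite !(mcoeff_mpoly_proot, mcoeffD) prootD.
Qed.

Lemma pchar_mpoly : p \in [pchar {mpoly F[n]}].
Proof.
rewrite inE (pcharf_prime pcharF)/= -mpolyC_nat (pcharf0 pcharF).
by rewrite mpolyC0.
Qed.

Lemma mcoeffMX_ngt (a : {mpoly F[n]}) m k : ~~ (m <= k)%MM -> (a * 'X_[m])@_k = 0.
Proof.
move=> mk; apply: memN_msupp_eq0; rewrite (perm_mem (msuppMX a m)).
by apply: contra mk => /mapP[m' _ ->]; exact: lem_addr.
Qed.

(** Frobenius is additive, so [u] may be taken to be a scaled monomial with exponent [m];
    coefficients then match because [m *+ p] divides [k *+ p] exactly when [m] divides [k]. *)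
Lemma mpoly_prootM a u : mpoly_proot (a * u ^+ p) = mpoly_proot a * u.
Proof.
elim/mpolyind: u => [|c m u _ _ IH].
  rewrite expr0n (gtn_eqF p_gt0) !mulr0.
  by apply/mpolyP => m; rewrite mcoeff_mpoly_proot !mcoeff0 proot0.
rewrite -(pFrobenius_autE pchar_mpoly) rmorphD/= !(pFrobenius_autE pchar_mpoly).
rewrite mulrDr mpoly_prootD IH mulrDr; congr (_ + _).
apply/mpolyP => k; rewrite mcoeff_mpoly_proot exprZn mpolyXn -!scalerAr !mcoeffZ prootM.
congr (_ * _); have [mk|mk] := boolP (m <= k)%MM.
  rewrite -(submK mk) addmC (_ : (m + (k - m)) *+ p = m *+ p + (k - m) *+ p)%MM.
    by rewrite !mcoeffMX mcoeff_mpoly_proot.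
  by apply/mnmP => i; rewrite !(mulmnE, mnmDE) mulnDl.
rewrite !mcoeffMX_ngt ?proot0//; apply: contra mk => /mnm_lepP mk.
by apply/mnm_lepP => i; have := mk i; rewrite !mulmnE leq_pmul2r.
Qed.

Lemma mpoly_frobenius_split Q : exists (q : nat) (T : {mpoly F[n]} -> {mpoly F[n]}),
  [/\ (Q <= q)%N, {morph T : x y / x + y}, T 1 = 1
    & forall a u, T (a * u ^+ q) = T a * u].
Proof.
exists (p ^ Q)%N, (iter Q mpoly_proot); split.
- by rewrite ltnW// ltn_expl// prime_gt1// (pcharf_prime pcharF).
- by elim: Q => [//|Q IH] x y; rewrite !iterS IH mpoly_prootD.
- elim: Q => [//|Q IH]; rewrite iterS IH; apply/mpolyP => m.
  rewrite mcoeff_mpoly_proot !mcoeff1 -!mdeg_eq0 mdegMn muln_eq0.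
  rewrite (gtn_eqF p_gt0) orbF.
  case: eqP => _; rewrite ?proot0//; apply: expp_inj.
  by rewrite /= prootK expr1n.
elim: Q => [a u|Q IH a u]; first by rewrite expr1.
by rewrite !iterS expnS exprM IH mpoly_prootM.
Qed.

End FrobeniusSplitting.

(** * Specialization to positive characteristic *)

(* Every finite piece of information about a field K is a statement about a
   finitely generated ring D mapping to K, here an iterated polynomial ring over
   the integers; it survives in positive characteristic if D maps to some
   algebraically closed field of that kind with a larger kernel. *)
Definition specializable (K : fieldType) (D : comNzRingType) (psi : {rmorphism D -> K}) :=
  forall e : D, psi e != 0 -> exists (F : closedFieldType) (p : nat) (phi : {rmorphism D -> F}),
    [/\ p \in [pchar F], phi e != 0 & forall x, psi x = 0 -> phi x = 0].

Lemma intr_abs_eq0 (K : fieldType) (x : int) : (x%:~R == 0 :> K) = (`|x|%N%:R == 0 :> K).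
Proof. by rewrite {1}[x]intEsign rmorphM rmorph_sign mulf_eq0 signr_eq0. Qed.

(** A positive characteristic of [K] is kept. In characteristic 0 the kernel is zero and any prime
    above [|e|] serves, as it does not divide [e]. *)
Lemma specializable_int (K : fieldType) : specializable (intr : {rmorphism int -> K}).
Proof.
move=> e; rewrite /= intr_abs_eq0 => e0.
suff [p [p_pr pe pK]] : exists p : nat, [/\ prime p, ~~ (p %| `|e|)%N &
    forall x : int, `|x|%N%:R = 0 :> K -> (p %| `|x|)%N].
  have [F [FpF _]] := countable_algebraic_closure 'F_p.
  have pcharF : p \in [pchar F] by rewrite (fmorph_pchar FpF) pchar_Fp.
  exists F, p, intr; split=> //=; first by rewrite intr_abs_eq0 -(dvdn_pcharf pcharF).
  move=> x /eqP; rewrite intr_abs_eq0 => /eqP/pK; rewrite (dvdn_pcharf pcharF).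
  by rewrite -intr_abs_eq0 => /eqP.
have [[p pK]|noK] := pselect (exists p, p \in [pchar K]).
  exists p; split; first exact: pcharf_prime pK.
    by rewrite (dvdn_pcharf pK).
  by move=> x /eqP; rewrite (dvdn_pcharf pK).
have natK0 : forall m : nat, (m%:R == 0 :> K) = (m == 0)%N.
  by apply/pcharf0P => p; apply/negP => pK; apply: noK; exists p.
have [p ep p_pr] := prime_above `|e|%N.
exists p; split=> //; last by move=> x /eqP; rewrite natK0 => /eqP ->.
by rewrite gtnNdvd// lt0n -natK0.
Qed.

Section Extension.
Variables (K : fieldType) (D : comNzRingType) (psi : {rmorphism D -> K}) (a : K).
Hypothesis psi_spec : specializable psi.

Let mu := map_poly psi.

Let ev (x : {poly D}) := (mu x).[a].

(** Pseudo-division seen through [psi]: [y] is first truncated to the size of [mu y], so that its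
    leading coefficient is not killed. *)
Let pdiv (x y : {poly D}) : mu y != 0 -> exists (j : nat) (u v : {poly D}),
  let c := y`_(size (mu y)).-1 ^+ j in [/\ psi c != 0, psi c *: mu x = mu u * mu y + mu v & (size (mu v) < size (mu y))%N].
Proof.
move=> y0; pose y' := take_poly (size (mu y)) y.
have muy' : mu y' = mu y.
  apply/polyP => i; rewrite !coef_map coef_take_poly; case: ltnP => // iy.
  by rewrite raddf0 -coef_map nth_default.
have size_y' : size y' = size (mu y).
  apply/eqP; rewrite eqn_leq size_take_poly/= -muy'; exact: size_poly.
have lcy' : lead_coef y' = y`_(size (mu y)).-1.
  by rewrite lead_coefE size_y' coef_take_poly prednK ?leqnn// size_poly_gt0.
exists (Pdiv.Ring.rscalp x y'), (Pdiv.Ring.rdivp x y'), (Pdiv.Ring.rmodp x y').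
rewrite -lcy'; split.
    by rewrite rmorphXn/= lcy' expf_neq0// -coef_map -lead_coefE lead_coef_eq0.
  by rewrite -map_polyZ Pdiv.ComRing.rdivp_eq rmorphD/= rmorphM/= -/mu muy'.
rewrite -size_y' (leq_ltn_trans (size_poly _ _))// Pdiv.Ring.ltn_rmodpN0//.
by apply: contraNneq y0 => y'0; rewrite -muy' y'0 /mu raddf0.
Qed.

Let min_size (P : {poly D} -> Prop) : (exists x, P x) ->
  exists2 x, P x & forall y, P y -> (size (mu x) <= size (mu y))%N.
Proof.
move=> [x0 Px0].
have exn : exists m, `[< exists2 x, P x & size (mu x) = m >].
  by exists (size (mu x0)); apply/asboolP; exists x0.
case: (ex_minnP exn) => m /asboolP[x Px <-] xmin.
by exists x => // y Py; apply: xmin; apply/asboolP; exists y.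
Qed.

(** The new variable goes to a suitable [b] in [F]. If [a] is transcendental over the image of [D],
    any [b] with [e] nonzero at [b] works; if [a] is algebraic, [b] is a root of a specialized
    minimal polynomial of [a]. *)
Lemma specializable_poly :
  specializable (horner_morph (fun x => mulrC a (psi x)) : {rmorphism {poly D} -> K}).
Proof.
move=> e e1; have {e1} e0 : ev e != 0 by [].
have ker_map (F : closedFieldType) (phi : {rmorphism D -> F}) :
    (forall x, psi x = 0 -> phi x = 0) ->
    forall x, mu x = 0 -> map_poly phi x = 0.
  move=> ker x /polyP x0; apply/polyP => i; rewrite coef_map coef0 /=.
  by apply: ker; have := x0 i; rewrite coef_map coef0.
have [transc|/existsNP[x1 /not_implyP[ex1 /eqP mux1]]] := pselect (forall x, ev x = 0 -> mu x = 0).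
  have mue : mu e != 0 by apply: contraNneq e0 => mue; rewrite /ev mue horner0.
  have [] := psi_spec (e := e`_(size (mu e)).-1).
    by rewrite -coef_map -lead_coefE lead_coef_eq0.
  move=> F [p [phi [pF phie ker]]].
  have [b eb] : exists b, (map_poly phi e).[b] != 0.
    have phie0 : map_poly phi e != 0.
      by apply: contraNneq phie => /polyP/(_ (size (mu e)).-1); rewrite coef_map coef0 => ->.
    have [/eqP/size_poly1P[c c0 ->]|s1] := eqVneq (size (map_poly phi e)) 1%N.
      by exists 0; rewrite hornerC.
    (* At a root of [e - 1] the nonconstant polynomial [e] takes the value 1. *)
    have [b] : exists b, root (map_poly phi e - 1) b.
      apply/closed_rootP; rewrite size_polyDl ?size_polyN ?size_poly1//.
      by rewrite ltn_neqAle eq_sym s1 size_poly_gt0.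
    rewrite rootE !hornerE subr_eq0 => /eqP eb.
    by exists b; rewrite eb oner_neq0.
  exists F, p, (horner_morph (fun x => mulrC b (phi x))); split=> // x.
  move=> /transc/(ker_map _ _ ker) x0.
  suff : (map_poly phi x).[b] = 0 by [].
  by rewrite x0 horner0.
(* [q] stands for the minimal polynomial of [a]. *)
have [q [evq muq] qmin] : exists2 x, ev x = 0 /\ mu x != 0 &
    forall y, ev y = 0 /\ mu y != 0 -> (size (mu x) <= size (mu y))%N.
  by apply: min_size; exists x1.
(* Bezout without fractions: [r] stands for the gcd of [e] and [q], and [u * e] agrees with it at
   [a]. It will turn out to be a constant. *)
have [r [er0 [u ru]] rmin] : exists2 x, ev x != 0 /\ (exists u, ev x = ev u * ev e) &
    forall y, ev y != 0 /\ (exists u, ev y = ev u * ev e) -> (size (mu x) <= size (mu y))%N.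
  by apply: min_size; exists e; split=> //; exists 1; rewrite /ev /mu rmorph1 hornerC mul1r.
have ker_small x : ev x = 0 -> (size (mu x) < size (mu q))%N -> mu x = 0.
  move=> ex; rewrite ltnNge; apply: contraNeq => mux; exact: qmin.
have evpdiv c x u' y v : psi c *: mu x = mu u' * mu y + mu v ->
    psi c * ev x = ev u' * ev y + ev v.
  by move=> /(congr1 (fun z => z.[a])); rewrite hornerZ hornerD hornerM.
have mur : mu r != 0 by apply: contraNneq er0 => mur; rewrite /ev mur horner0.
(* At [a], the remainder of [r] by [q] is a nonzero multiple of [r], hence competes with [r] for
   minimality. *)
have rq : (size (mu r) < size (mu q))%N.
  have [j [u' [v []]]] := pdiv r muq; set c := _ ^+ j => c0 /evpdiv rE vq.
  apply: leq_ltn_trans vq; apply: rmin.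
  rewrite evq mulr0 add0r in rE; rewrite -rE; split; first by rewrite mulf_neq0.
  exists (c *: u); rewrite ru mulrA /ev; congr (_ * _).
  by rewrite /mu map_polyZ hornerZ.
(* By minimality of [r], the remainder of [q] by [r] vanishes at [a], hence is zero by minimality of
   [q]. The quotient then vanishes at [a] too, and were [r] not constant it would be smaller than
   [q]. *)
have r1 : (size (mu r) <= 1)%N.
  have [j [u' [v [c0 qE vr]]]] := pdiv q mur.
  have := evpdiv _ _ _ _ _ qE; rewrite evq mulr0 => /esym/eqP; rewrite addr_eq0 => /eqP u'r.
  have [ev0|ev0] := eqVneq (ev v) 0; last first.
    suff : (size (mu r) <= size (mu v))%N by rewrite leqNgt vr.
    apply: rmin; split=> //; exists (- (u' * u)).
    rewrite -[LHS]opprK -u'r ru mulrA -mulNr; congr (_ * _).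
    by rewrite /ev /mu rmorphN rmorphM/= hornerN hornerM.
  have mv0 : mu v = 0 by apply: ker_small => //; exact: ltn_trans rq.
  have eu' : ev u' = 0.
    by apply/eqP; move: u'r; rewrite ev0 oppr0 => /eqP; rewrite mulf_eq0 (negbTE er0) orbF.
  rewrite leqNgt; apply/negP => r1.
  have mu'0 : mu u' != 0.
    apply: contraNneq muq => mu'0; move: qE; rewrite mu'0 mul0r mv0 addr0 => /eqP.
    by rewrite scaler_eq0 (negbTE c0).
  have /negP[] := mu'0; apply/eqP; apply: ker_small => //.
  have := congr1 (fun z : {poly K} => size z) qE.
  rewrite mv0 addr0 /= size_scale// size_mul// => ->.
  by rewrite -ltnS prednK ?addn_gt0 ?size_poly_gt0 ?mu'0// -addn2 leq_add2l.
have evr : ev r = psi r`_0 by rewrite /ev (size1_polyC r1) hornerC coef_map.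
have [] := psi_spec (e := q`_(size (mu q)).-1 * r`_0).
  by rewrite rmorphM/= -coef_map -lead_coefE -evr mulf_neq0// lead_coef_eq0.
move=> F [p [phi [pF]]]; rewrite rmorphM mulf_eq0 negb_or => /andP[phiq phir] ker.
have [b /eqP qb] : exists b, root (map_poly phi q) b.
  apply/closed_rootP; apply: contraNneq phiq => sq.
  have := leq_sizeP _ _ (eq_leq sq) (size (mu q)).-1; rewrite coef_map => -> //.
  by rewrite -ltnS prednK ?size_poly_gt0// (leq_ltn_trans _ rq)// size_poly_gt0.
(* Whatever vanishes at [a] is, up to a power of the leading coefficient of [q], a multiple of [q]
   modulo the kernel; that coefficient survives in [F]. *)
have kerb x : ev x = 0 -> (map_poly phi x).[b] = 0.
  move=> ex; have [j [u' [v [/= _ xE vq]]]] := pdiv x muq.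
  have mv0 : mu v = 0.
    apply: ker_small => //; have := evpdiv _ _ _ _ _ xE.
    by rewrite ex evq !mulr0 add0r.
  have := ker_map _ _ ker (q`_(size (mu q)).-1 ^+ j *: x - u' * q).
  rewrite /mu !rmorphB/= !map_polyZ !rmorphM/= -/mu xE mv0 addr0 subrr => /(_ erefl).
  move=> /(congr1 (fun z => z.[b])); rewrite horner0 hornerD hornerN hornerM qb mulr0 subr0.
  by rewrite hornerZ rmorphXn/= => /eqP; rewrite mulf_eq0 expf_eq0 (negbTE phiq) andbF => /eqP.
exists F, p, (horner_morph (fun x => mulrC b (phi x))); split=> //.
suff : (map_poly phi e).[b] != 0 by [].
have /kerb : ev ((r`_0)%:P - u * e) = 0.
  rewrite /ev /mu rmorphB rmorphM/= hornerD hornerN hornerM map_polyC hornerC /=.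
  by rewrite -/mu -/(ev u) -/(ev e) -ru evr subrr.
rewrite rmorphB rmorphM/= map_polyC hornerD hornerN hornerM hornerC /=.
move=> /eqP; rewrite subr_eq0 => /eqP phirE.
by apply: contraNneq phir => e0'; rewrite phirE e0' mulr0.
Qed.

End Extension.

(** Each element of the list adds one variable, mapped to that element. *)
Lemma specializable_lift (K : fieldType) (s : seq K) :
  exists (D : comNzRingType) (psi : {rmorphism D -> K}) (c : K -> D),
    specializable psi /\ {in s, cancel c psi}.
Proof.
elim: s => [|a s [D [psi [c [psi_spec cK]]]]].
  by exists int, intr, (fun=> 0); split=> //; exact: specializable_int.
exists {poly D}, (horner_morph (fun x => mulrC a (psi x))).
exists (fun x => if x == a then 'X else (c x)%:P); split; first exact: specializable_poly.
move=> x; rewrite inE; case: eqVneq => [-> _|_ /= xs]; first exact: horner_morphX.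
by apply: etrans (cK _ xs); exact: horner_morphC.
Qed.

(** * Hilbert basis theorem *)

Section Dickson.
Implicit Types (u : nat -> nat).

Lemma nondecreasing_subseq u : exists phi : nat -> nat,
  (forall i j, (i < j)%N -> (phi i < phi j)%N) /\
  (forall i j, (i <= j)%N -> (u (phi i) <= u (phi j))%N).
Proof.
(* [m i] is a place where [u] attains its minimum over the indices from [i] on; a sequence of such
   places is nondecreasing. *)
have /choice[m mP] : forall i, exists m, (i <= m)%N /\ forall j, (i <= j)%N -> (u m <= u j)%N.
  move=> i; have exv : exists v, `[< exists2 m, (i <= m)%N & u m = v >].
    by exists (u i); apply/asboolP; exists i.
  case: (ex_minnP exv) => v /asboolP[m im <-] vmin; exists m; split=> // j ij.
  by apply: vmin; apply/asboolP; exists j.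
pose phi := fix phi i := if i is i'.+1 then m (phi i').+1 else m 0%N.
have phiS i : (phi i < phi i.+1)%N by case: (mP (phi i).+1).
have phi_lt i j : (i < j)%N -> (phi i < phi j)%N.
  elim: j => // j IH; rewrite ltnS leq_eqVlt => /orP[/eqP ->//|/IH ij].
  exact: ltn_trans (phiS j).
exists phi; split=> // i j; rewrite leq_eqVlt => /orP[/eqP ->//|ij].
case: i ij => [|i] ij; first by case: (mP 0%N) => _; apply.
by case: (mP (phi i).+1) => _; apply; apply: phi_lt; exact: ltnW.
Qed.

(** Subsequences are extracted one coordinate at a time, keeping the coordinates already treated
    nondecreasing. *)
Lemma dickson n (u : nat -> 'X_{1..n}) : exists i j, (i < j)%N /\ (u i <= u j)%MM.
Proof.
suff /(_ n (leqnn n))[phi [phi_lt phi_le]] : forall k, (k <= n)%N -> exists phi : nat -> nat,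
    (forall i j, (i < j)%N -> (phi i < phi j)%N) /\
    (forall l : 'I_n, (l < k)%N -> forall i j, (i <= j)%N -> (u (phi i) l <= u (phi j) l)%N).
  exists (phi 0%N), (phi 1%N); split; first exact: phi_lt.
  by apply/mnm_lepP => l; exact: phi_le.
elim=> [_|k IH kn]; first by exists id.
have [phi [phi_lt phi_le]] := IH (ltnW kn).
have [psi [psi_lt psi_le]] := nondecreasing_subseq (fun i => u (phi i) (Ordinal kn)).
exists (phi \o psi); split=> [i j ij|l lk i j ij]; first exact/phi_lt/psi_lt.
move: lk; rewrite ltnS leq_eqVlt => /orP[/eqP lk|lk].
  by have := psi_le i j ij; rewrite (_ : Ordinal kn = l)//; apply: val_inj.
apply: phi_le => //; move: ij; rewrite leq_eqVlt => /orP[/eqP ->//|ij].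
exact/ltnW/psi_lt.
Qed.

End Dickson.

Section HilbertBasis.
Variables (k : fieldType) (n : nat).
Implicit Types (I : set {mpoly k[n]}).

(** Otherwise each finite list could be extended by an element of [I] whose leading monomial no
    earlier one divides, against Dickson's lemma. *)
Lemma mlead_basis I : exists s : seq {mpoly k[n]}, (forall x, x \in s -> I x /\ x != 0) /\
  forall h, I h -> h != 0 -> exists2 x, x \in s & (mlead x <= mlead h)%MM.
Proof.
pose ok (s : seq {mpoly k[n]}) := forall x, x \in s -> I x /\ x != 0.
apply: contrapT => nobasis.
have /choice[h hP] : forall s, exists h, ok s ->
    [/\ I h, h != 0 & forall x, x \in s -> ~~ (mlead x <= mlead h)%MM].
  move=> s; apply: contrapT => nh; apply: nobasis; exists s.
  have [oks|noks] := pselect (ok s); last by case: nh; exists 0.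
  split=> // h Ih h0; apply: contrapT => noth; apply: nh; exists h => _; split=> // x xs.
  by apply/negP => xh; apply: noth; exists x.
pose S := fix S i := if i is i'.+1 then h (S i') :: S i' else [::].
have okS i : ok (S i).
  elim: i => [//|i IH] x; rewrite inE => /orP[/eqP ->|/IH//].
  by have [] := hP _ IH.
have hS i j : (i < j)%N -> h (S i) \in S j.
  elim: j => // j IH; rewrite ltnS leq_eqVlt => /orP[/eqP ->|/IH ij]; rewrite inE ?eqxx//.
  by rewrite ij orbT.
have [i [j [ij]]] := dickson (fun i => mlead (h (S i))).
by have [_ _ /(_ _ (hS _ _ ij))/negbTE ->] := hP _ (okS j).
Qed.

Lemma hilbert_basis I : is_ideal I -> exists (l : nat) (g : 'I_l -> {mpoly k[n]}),
  I = ideal_gen (range g).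
Proof.
move=> iI; have [s [sI sP]] := mlead_basis I.
exists (size s), (fun i => s`_i); rewrite eqEsubset; split; last first.
  by apply: ideal_gen_min => // _ [i _ <-]; have [] := sI _ (mem_nth 0 (ltn_ord i)).
pose J := ideal_gen (range (fun i : 'I_(size s) => s`_i)).
have iJ : is_ideal J by exact: ideal_gen_ideal.
suff all_lead m : forall h, I h -> mlead h = m -> J h by move=> h /all_lead; apply.
elim: m / (ltom_wf m) => m _ IH h Ih hm.
have [->|h0] := eqVneq h 0; first by case: iJ.
have [x xs xh] := sP h Ih h0; have [Ix x0] := sI x xs.
have Jx : J x.
  have := @mem_ideal_gen_range _ _ (fun i : 'I_(size s) => s`_i) (Ordinal (etrans (index_mem x s) xs)).
  by rewrite /= nth_index.
(* Division step: [y * x] has the leading term of [h], so the difference has a smaller leading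
   monomial. *)
pose c := mleadc h / mleadc x; pose y := c *: 'X_[mlead h - mlead x].
have y0 : c != 0 by rewrite mulf_neq0 ?invr_eq0 ?mleadc_eq0.
have yxlead : mlead (y * x) = mlead h.
  have y0' : y != 0 by rewrite scaler_eq0 negb_or y0 -mleadc_eq0 mleadXm mcoeffX eqxx oner_eq0.
  by rewrite mleadM// /y mleadZ// mleadXm submK.
have yxc : mleadc (y * x) = mleadc h.
  by rewrite yxlead -{1}(submK xh) -scalerAl mcoeffZ [_ * x]mulrC mcoeffMX divfK ?mleadc_eq0.
have [h'0|h'0] := eqVneq (h - y * x) 0.
  by move/eqP: h'0; rewrite subr_eq0 => /eqP ->; exact: (idealM _ iJ).
rewrite -(subrK (y * x) h); refine (idealD iJ _ _); last exact: (idealM _ iJ).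
apply: (IH (mlead (h - y * x))) => //; last first.
  by rewrite addrC -mulNr; case: iI => _; apply.
rewrite -hm lt_neqAle; apply/andP; split.
  apply: contraNneq h'0 => h'E.
  by rewrite -mleadc_eq0 h'E mcoeffB -{2}yxlead yxc subrr.
by apply: le_trans (mleadB_le _ _) _; rewrite yxlead joinxx.
Qed.

End HilbertBasis.

(** * Graded ideals *)

Section Separation.
Variables (K : fieldType).

(** A matrix of maximal rank with row space inside [W] has row space [W]; its cokernel kills [W],
    and some column of it does not kill [v]. *)
Lemma separating_vector (N : nat) (W : set 'rV[K]_N) (v : 'rV[K]_N) :
  W 0 -> (forall a x y, W x -> W y -> W (a *: x + y)) -> ~ W v ->
  exists y : 'cV[K]_N, (forall w, W w -> w *m y = 0) /\ v *m y = 1%:M.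
Proof.
move=> W0 WZ Wv; pose sub (M : 'M[K]_N) := forall u : 'rV_N, (u <= M)%MS -> W u.
have exr : exists r, `[< exists2 M, sub M & \rank M = r >].
  exists 0%N; apply/asboolP; exists 0; last exact: mxrank0.
  by move=> u; rewrite submx0 => /eqP ->.
have ubr r : `[< exists2 M, sub M & \rank M = r >] -> (r <= N)%N.
  by move=> /asboolP[M _ <-]; exact: rank_leq_row.
case: (ex_maxnP exr ubr) => r /asboolP[M subM <-] maxM.
have WM w : W w -> (w <= M)%MS.
  move=> Ww; have subMw : sub (M + w)%MS.
    move=> u /sub_addsmxP[[u1 u2] ->] /=.
    rewrite addrC [u2]mx11_scalar mul_scalar_mx; apply: WZ => //.
    by apply: subM; exact: submxMl.
  have rMw : (\rank (M + w)%MS <= \rank M)%N by apply: maxM; apply/asboolP; exists (M + w)%MS.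
  have := mxrank_leqif_sup (addsmxSl M w); case=> rle rE.
  by apply: submx_trans (addsmxSr M w) _; rewrite -rE eqn_leq rle.
have : ~~ (v <= M)%MS by apply/negP => /subM.
rewrite submxE => /matrix0Pn[i [j]]; rewrite ord1 => vj.
move: vj; set c := (_ *m _) 0 j => c0.
exists (c^-1 *: (cokermx M *m delta_mx j 0)); split=> [w /WM|].
  by rewrite submxE => /eqP wM; rewrite -scalemxAr mulmxA wM mul0mx scaler0.
rewrite -scalemxAr mulmxA -colE; apply/matrixP => i' j'.
by rewrite !ord1 [LHS]mxE [X in _ * X]mxE [RHS]mxE eqxx mulVf.
Qed.

End Separation.

Section Graded.
Variables (K : fieldType) (n : nat).
Implicit Types (J : set {mpoly K[n]}).

Local Notation part := (pihomog mdeg).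

Definition graded J := forall h d, J h -> J (part d h).

Lemma mcoeff_pihomog d (h : {mpoly K[n]}) m :
  (part d h)@_m = if mdeg m == d then h@_m else 0.
Proof.
case: eqP => [<-|/eqP md]; last exact: dhomog_nemf_coeff (pihomogP _ _ _) md.
have [mh|hm] := ltnP (mdeg m) (msize h); last first.
  rewrite /pihomog raddf_sum/= [RHS]memN_msupp_eq0.
    rewrite big_seq_cond big1// => i /andP[ih /eqP im].
    by move: hm; rewrite -im leqNgt msize_mdeg_lt.
  by apply/negP => /msize_mdeg_lt; rewrite ltnNge hm.
rewrite {2}(pihomog_partitionE (leqnn (msize h))) [RHS]raddf_sum/=.
rewrite [RHS](bigD1 (Ordinal mh))//= big1 ?addr0// => i im.
by apply: dhomog_nemf_coeff (pihomogP _ _ _) _; rewrite eq_sym.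
Qed.

Lemma graded_gen (T : Type) (g : T -> {mpoly K[n]}) :
  (forall t, exists d, g t \is d.-homog) -> graded (ideal_gen (range g)).
Proof.
move=> gh h d /ideal_gen_range[s ->]; rewrite raddf_sum/=.
have iJ := ideal_gen_ideal (range g).
refine (ideal_sum _ iJ _) => -[c t] _ /=; have [e te] := gh t.
elim/mpolyind: c => [|a m c _ _ IH]; first by rewrite mul0r raddf0; case: iJ.
rewrite mulrDl raddfD/=; refine (idealD iJ _ IH).
have mt : a *: 'X_[m] * g t \is (mdeg m + e).-homog.
  by apply: dhomogM => //; apply: dhomogZ; rewrite dhomogX.
have [<-|de] := eqVneq (mdeg m + e)%N d.
  by rewrite pihomog_dE//; exact: (idealM _ iJ (@mem_ideal_gen_range _ _ g t)).
by rewrite (pihomog_ne0 de mt); case: iJ.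
Qed.

(** For a graded ideal, membership of [f] depends only on coefficients below a bounded degree. This
    makes separation a finite-dimensional problem. *)
Lemma graded_trunc J D f h : is_ideal J -> graded J -> J h -> (msize f <= D)%N ->
  (forall m, (mdeg m < D)%N -> f@_m = h@_m) -> J f.
Proof.
move=> iJ gJ Jh fD fh; rewrite (pihomog_partitionE fD).
refine (ideal_sum _ iJ _) => d _.
rewrite (_ : part d f = part d h); first exact: gJ.
apply/mpolyP => m; rewrite !mcoeff_pihomog; case: eqP => // md.
by apply: fh; rewrite md.
Qed.

End Graded.

Section CoefficientFunctional.

(** Stated over any commutative ring, so that the functional can be lifted to [D] and specialized to
    [F]. *)
Definition coef_form (R : comNzRingType) (n D : nat) (y : 'X_{1..n < D} -> R)
  (h : {mpoly R[n]}) : R := \sum_m y m * h@_m.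

Lemma coef_form_is_linear (R : comNzRingType) (n D : nat) (y : 'X_{1..n < D} -> R) a h h' :
  coef_form y (a *: h + h') = a * coef_form y h + coef_form y h'.
Proof.
rewrite /coef_form mulr_sumr -big_split/=; apply: eq_bigr => m _.
by rewrite mcoeffD mcoeffZ mulrDr mulrCA.
Qed.

Lemma coef_form0 (R : comNzRingType) (n D : nat) (y : 'X_{1..n < D} -> R) : coef_form y 0 = 0.
Proof. by rewrite /coef_form big1// => m _; rewrite mcoeff0 mulr0. Qed.

Lemma coef_formD (R : comNzRingType) (n D : nat) (y : 'X_{1..n < D} -> R) :
  {morph coef_form y : h h' / h + h'}.
Proof. by move=> h h'; rewrite -[h]scale1r coef_form_is_linear mul1r scale1r. Qed.

Lemma rmorph_coef_form (R S : comNzRingType) (phi : {rmorphism R -> S}) (n D : nat)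
    (y : 'X_{1..n < D} -> R) h :
  phi (coef_form y h) = coef_form (phi \o y) (map_mpoly phi h).
Proof.
rewrite /coef_form rmorph_sum/=; apply: eq_bigr => m _.
by rewrite rmorphM/= mcoeff_map_mpoly.
Qed.

Lemma graded_separation (K : fieldType) (n : nat) (J : set {mpoly K[n]}) f :
  is_ideal J -> graded J -> ~ J f ->
  exists (D : nat) (y : 'X_{1..n < D} -> K),
    (forall h, J h -> coef_form y h = 0) /\ coef_form y f = 1.
Proof.
move=> iJ gJ Jf; pose D := msize f; pose T : finType := 'X_{1..n < D}.
pose row (h : {mpoly K[n]}) : 'rV[K]_#|T| := \row_i h@_(enum_val i : T).
have rowE (h : {mpoly K[n]}) (y : 'cV[K]_#|T|) :
    (row h *m y) 0 0 = coef_form (fun m : T => y (enum_rank m) 0) h.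
  rewrite mxE /coef_form (reindex (@enum_rank T))/=; last exact/onW_bij/enum_rank_bij.
  by apply: eq_bigr => m _; rewrite mxE enum_rankK mulrC.
have rowL a h h' : row (a *: h + h') = a *: row h + row h'.
  by apply/rowP => i; rewrite !mxE mcoeffD mcoeffZ.
have [|||y [yJ yf]] := @separating_vector K #|T| (row @` J) (row f).
- exists 0; first by case: iJ.
  by apply/rowP => i; rewrite !mxE mcoeff0.
- move=> a _ _ [h Jh <-] [h' Jh' <-]; exists (a *: h + h') => //.
  rewrite -mul_mpolyC; exact: (iJ.2).
- move=> [h Jh hf]; apply: Jf; apply: (graded_trunc iJ gJ Jh (leqnn _)) => m mf.
  have /rowP/(_ (enum_rank (BMultinom mf : T))) := hf.
  by rewrite !mxE enum_rankK/=.
exists D, (fun m : T => y (enum_rank m) 0); split=> [h Jh|]; rewrite -rowE.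
  by rewrite yJ ?mxE//; exists h.
by rewrite yf mxE eqxx.
Qed.

End CoefficientFunctional.

(** * Weak Briancon-Skoda theorem *)

Section WeakBrianconSkoda.

Lemma map_mpoly_lift (D : nzRingType) (K : nzRingType) (psi : {rmorphism D -> K})
    (c : K -> D) (n : nat) (h : {mpoly K[n]}) :
  {in [seq h@_m | m <- msupp h], cancel c psi} ->
  map_mpoly psi (\sum_(m <- msupp h) c h@_m *: 'X_[m]) = h.
Proof.
move=> cK; rewrite raddf_sum/= [RHS]mpolyE big_seq [RHS]big_seq.
apply: eq_bigr => m mh; rewrite map_mpolyZ map_mpolyX cK//.
by apply/mapP; exists m.
Qed.

Lemma map_mpoly_ker (D K F : comNzRingType) (psi : {rmorphism D -> K})
    (phi : {rmorphism D -> F}) (n : nat) (h h' : {mpoly D[n]}) :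
  (forall x, psi x = 0 -> phi x = 0) -> map_mpoly psi h = map_mpoly psi h' ->
  map_mpoly phi h = map_mpoly phi h'.
Proof.
move=> ker hh'; apply/mpolyP => m; rewrite !mcoeff_map_mpoly.
apply/eqP; rewrite -subr_eq0 -rmorphB; apply/eqP/ker.
by have := congr1 (mcoeff m) hh'; rewrite rmorphB !mcoeff_map_mpoly => ->; rewrite subrr.
Qed.

Lemma graded_briancon_skoda (K : fieldType) (n l : nat) (g : 'I_l -> {mpoly K[n]})
    (r N : nat) (f : {mpoly K[n]}) :
  let J := ideal_gen (range g) in
  graded (ideal_pow J r) -> (0 < N)%N -> ideal_pow J (N * (r + l)) (f ^+ N) ->
  ideal_pow J r f.
Proof.
move=> J gJ N0 /ideal_powP[s fE]; apply: contrapT => Jf.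
have [d [y [yJ yf]]] := graded_separation (ideal_pow_ideal _ _) gJ Jf.
pose coefs (h : {mpoly K[n]}) := [seq h@_m | m <- msupp h].
(* All the elements of [K] that enter the functional, [f], the generators and the expression of
   [f ^+ N]. *)
pose L := [seq y m | m : 'X_{1..n < d}] ++ coefs f ++
  flatten [seq coefs (g i) | i : 'I_l] ++ flatten [seq coefs a.1 | a <- s].
have [D [psi [c [psi_spec cK]]]] := specializable_lift L.
pose lift (h : {mpoly K[n]}) : {mpoly D[n]} := \sum_(m <- msupp h) c h@_m *: 'X_[m].
have liftK h : {subset coefs h <= L} -> map_mpoly psi (lift h) = h.
  by move=> hL; apply: map_mpoly_lift => x /hL; exact: cK.
have liftf : map_mpoly psi (lift f) = f.
  by apply: liftK => x xf; rewrite !mem_cat xf orbT.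
have liftg i : map_mpoly psi (lift (g i)) = g i.
  apply: liftK => x xg; rewrite !mem_cat; apply/orP; right; apply/orP; right.
  apply/orP; left; apply/flattenP; exists (coefs (g i)) => //.
  by apply: map_f; rewrite mem_enum.
have lifts a : a \in s -> map_mpoly psi (lift a.1) = a.1.
  move=> sa; apply: liftK => x xa; rewrite !mem_cat; do 3![apply/orP; right].
  by apply/flattenP; exists (coefs a.1) => //; exact: map_f.
have [z yE] : exists z, y = psi \o z.
  by exists (c \o y); apply/funext => m /=; rewrite cK// mem_cat map_f// mem_enum.
(* The failure of membership is the equation [coef_form y f = 1], which the kernel inclusion
   preserves; so nothing beyond [1] has to stay nonzero. *)
have [] := psi_spec 1; first by rewrite rmorph1 oner_eq0.
move=> F [p [phi [pF _ ker]]].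
pose f' := map_mpoly phi (lift f); pose g' i := map_mpoly phi (lift (g i)).
pose y' := phi \o z.
have liftprod M (w : M.-tuple 'I_l) :
    map_mpoly psi (\prod_(i <- w) lift (g i)) = \prod_(i <- w) g i.
  by rewrite rmorph_prod; apply: eq_bigr => i _; exact: liftg.
have form_ker h h' : coef_form y (map_mpoly psi h) = coef_form y (map_mpoly psi h') ->
    coef_form y' (map_mpoly phi h) = coef_form y' (map_mpoly phi h').
  rewrite yE -!rmorph_coef_form => hh'; apply/eqP; rewrite -subr_eq0 -rmorphB.
  by apply/eqP/ker/eqP; rewrite rmorphB subr_eq0 hh'.
have f'E : f' ^+ N = \sum_(a <- s) map_mpoly phi (lift a.1) * \prod_(i <- a.2) g' i.
  rewrite -rmorphXn/=.
  have -> : \sum_(a <- s) map_mpoly phi (lift a.1) * \prod_(i <- a.2) g' i =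
      map_mpoly phi (\sum_(a <- s) lift a.1 * \prod_(i <- a.2) lift (g i)).
    by rewrite rmorph_sum; apply: eq_bigr => a _; rewrite rmorphM rmorph_prod.
  apply: (map_mpoly_ker ker); rewrite rmorphXn/= liftf fE rmorph_sum/= big_seq [RHS]big_seq.
  by apply: eq_bigr => a sa; rewrite rmorphM/= lifts// liftprod.
have y'f' : coef_form y' f' = 1.
  apply/eqP; rewrite -subr_eq0.
  have -> : coef_form y' f' - 1 = phi (coef_form z (lift f) - 1).
    by rewrite rmorphB rmorph_coef_form rmorph1.
  by apply/eqP/ker; rewrite rmorphB rmorph_coef_form -yE liftf yf rmorph1 subrr.
(* Multipliers over [F] need not lift to [D], but monomials do, and linearity over [F] gives the
   rest. *)
have y'g' (w : r.-tuple 'I_l) m : coef_form y' ('X_[m] * \prod_(i <- w) g' i) = 0.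
  have := form_ker ('X_[m] * \prod_(i <- w) lift (g i)) 0.
  rewrite !raddf0 !coef_form0 !rmorphM/= !map_mpolyX liftprod rmorph_prod => -> //.
  apply: yJ; refine (idealM _ (ideal_pow_ideal _ _) _).
  by rewrite ideal_pow_gen_range; exact: (@mem_ideal_gen_range _ _ _ w).
have /ideal_powP[s' f'E'] : ideal_pow (ideal_gen (range g')) r f'.
  apply: (split_briancon_skoda (mpoly_frobenius_split n pF) N0).
  apply/ideal_powP; exists [seq (map_mpoly phi (lift a.1), a.2) | a <- s].
  by rewrite f'E big_map.
move: y'f'; rewrite f'E' (big_morph _ (@coef_formD _ _ _ y') (@coef_form0 _ _ _ y')).
rewrite big1 => [/esym/eqP|a _]; first by rewrite oner_eq0.
elim/mpolyind: (a.1) => [|b m u _ _ IH]; first by rewrite mul0r coef_form0.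
by rewrite mulrDl -scalerAl coef_form_is_linear y'g' mulr0 add0r IH.
Qed.

End WeakBrianconSkoda.

(** * Boundedness of the noncontainments *)

Lemma homogeneous_pow_graded (k : fieldType) (n : nat) (I : set {mpoly k[n]}) r :
  is_homogeneous_ideal I -> graded (ideal_pow I r).
Proof.
move=> ->; set S := [set p | _].
have -> : S = range (fun x : {p | S p} => sval x).
  by rewrite eqEsubset; split=> [p Sp|_ [[p Sp] _ <-]//]; exists (exist _ p Sp).
rewrite ideal_pow_gen_range; apply: graded_gen => w.
elim/big_rec: _ => [|[p [_ [d pd]]] q _ [e qe]] /=; first by exists 0%N; exact: dhomog1.
by exists (d + e)%N; exact: dhomogM.
Qed.

(** [L] counts generators from the basis theorem, which need not be homogeneous; gradedness of the
    powers comes from the homogeneous elements of [I]. *)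
Lemma homogeneous_briancon_skoda (k : fieldType) (n : nat) (I : set {mpoly k[n]}) :
  is_homogeneous_ideal I -> exists L : nat, forall (r N : nat) f,
    (0 < N)%N -> ideal_pow I (N * (r + L)) (f ^+ N) -> ideal_pow I r f.
Proof.
move=> Ihom; have iI : is_ideal I by rewrite Ihom; exact: ideal_gen_ideal.
have [l [g Ig]] := hilbert_basis iI.
exists l => r N f; have := @homogeneous_pow_graded _ _ _ r Ihom.
by rewrite Ig; exact: graded_briancon_skoda.
Qed.

(* A quotient [p / q] strictly between rho_a and [s0 / r0] has infinitely many t
   with I^(pt) in I^(qt); raising f in I^(s) to a large power N and comparing
   with such a t puts [f ^+ N] in [I ^ (N * (r + L))] once r is large. *)
Lemma noncontainment_bounded (k : fieldType) (n : nat) (I : set {mpoly k[n]})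
    (p q s0 r0 : nat) :
  is_homogeneous_ideal I -> (0 < p)%N -> (0 < q)%N -> (0 < r0)%N -> (p * r0 < s0 * q)%N ->
  (forall t0, exists2 t, (t0 <= t)%N & symbolic_pow I (p * t) `<=` ideal_pow I (q * t)) ->
  exists B, forall s r, (0 < s)%N -> (s0 * r <= s * r0)%N ->
    ~ (symbolic_pow I s `<=` ideal_pow I r) -> (s < B)%N /\ (r < B)%N.
Proof.
move=> Ihom p0 q0 r00 pq often; have [L IL] := homogeneous_briancon_skoda Ihom.
(* The integer gap [c < s0 * q] yields a surplus [r * N.-1], which has to absorb [c * r] and
   [c * L * N]. With [N.-1 >= 2 * c + 2] and [r > 4 * c * L] each is at most half of it. *)
pose c := (p * r0)%N; pose B := (4 * c * L).+1.
have [t1 Bt1 t1I] := often B.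
(* Bounding [r] suffices: for [r < B] and [s >= p * t1], the containment at [t1 >= B] already puts
   I^(s) inside I^r. *)
suff rB s r : (0 < s)%N -> (s0 * r <= s * r0)%N ->
    ~ (symbolic_pow I s `<=` ideal_pow I r) -> (r < B)%N.
  exists (maxn (p * t1) B) => s r s_gt0 sr nsr; have rltB := rB s r s_gt0 sr nsr.
  split; last by rewrite leq_max rltB orbT.
  rewrite leq_max; have [//|ps] := ltnP s (p * t1).
  case: nsr => f /(symbolic_pow_sub ps)/t1I; apply: ideal_pow_sub.
  by rewrite (leq_trans (ltnW rltB))// (leq_trans Bt1)// leq_pmull.
move=> s_gt0 sr; apply: contra_notT; rewrite -leqNgt => Br f fs.
have [t tge tI] := often (s * (2 * c + 2))%N.
(* Rounding up puts [f ^+ N] in I^(pt), hence in I^(qt); [t] was taken large to make [N] large. *)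
pose N := ((p * t) %/ s).+1.
have Ns : (p * t <= s * N)%N by rewrite [(s * N)%N]mulnC ltnW// ltn_ceil.
have N1s : (s * N.-1 <= p * t)%N by rewrite mulnC leq_trunc_div.
have N1 : (2 * c + 2 <= N.-1)%N.
  by rewrite leq_divRL// mulnC (leq_trans tge)// leq_pmull.
apply: (IL r N f) => //.
suff : (N * (r + L) <= q * t)%N.
  move=> /ideal_pow_sub; apply; apply: tI.
  by apply: symbolic_pow_sub Ns _ _; exact: symbolic_powX.
have h1 : (p * r0 * r + r <= s * r0 * q)%N.
  have : ((p * r0).+1 * r <= s0 * q * r)%N by rewrite leq_mul2r pq orbT.
  have : (s0 * r * q <= s * r0 * q)%N by rewrite leq_mul2r sr orbT.
  by rewrite mulSn; lia.
rewrite -(leq_pmul2l (_ : 0 < c)%N) ?muln_gt0 ?p0//.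
have h2 : ((c * r + r) * N.-1 <= c * (q * t))%N.
  apply: (leq_trans (leq_mul h1 (leqnn _))).
  have := leq_mul (leqnn (r0 * q)) N1s; rewrite /c; lia.
apply: leq_trans h2.
have h3 : (2 * c * r <= N.-1 * r)%N by rewrite leq_mul2r; apply/orP; right; lia.
have h4 : (4 * c * L * N.-1 <= r * N.-1)%N by rewrite leq_mul2r ltnW ?orbT.
have h5 : (c * L * 2 <= c * L * N.-1)%N by rewrite leq_mul2l; apply/orP; right; lia.
rewrite -[in leqLHS](prednK (ltn0Sn _ : (0 < N)%N)) mulSn; nia.
Qed.

(** * Attainment of the supremum *)

Theorem lemma3p2 (R : realType) (k : fieldType) (n : nat)
  (I : set {mpoly k[n.+1]}) (h : nat)
  (I_nonzero : I <> [set 0])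
  (I_proper : I <> setT)
  (I_homogeneous : is_homogeneous_ideal I)
  (I_radical : is_radical_ideal I)
  (I_big_height : is_big_height I h)
  (rho_gt : (asymptotic_resurgence R I < resurgence R I)%E)
  (r1 : nat) (r1_gt0 : (0 < r1)%N)
  (rho_a_eq : asymptotic_resurgence R I
              = ((h%:R * r1%:R - h%:R) / r1%:R)%:E) :
  exists F : {fset nat * nat},
    [/\ F <> fset0,
        (forall s r : nat, (s, r) \in F ->
           [/\ (0 < s)%N, (0 < r)%N
             & ~ (symbolic_pow I s `<=` ideal_pow I r)])
      & resurgence R I
        = (\big[maxe/-oo]_(sr <- F) ((sr.1)%:R / (sr.2)%:R)%:E)%E].
Proof.
have [z [s0 [r0 [s00 r00 ns0 ->{z}]]] asr0] : exists2 z, (exists m r : nat,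
    [/\ (0 < m)%N, (0 < r)%N, ~ (symbolic_pow I m `<=` ideal_pow I r)
      & z = (m%:R / r%:R : R)%:E]) & (asymptotic_resurgence R I < z)%E.
  by have [z] := ereal_sup_gt rho_gt; exists z.
move: asr0; rewrite rho_a_eq lte_fin; set a := (X in X < _) => asr0.
have r0R : (0 : R) < r0%:R by rewrite ltr0n.
have d0 : 0 < s0%:R - a * r0%:R by rewrite subr_gt0 -ltr_pdivlMr.
(* Scaling [s0 / r0] by [j] leaves room to lower the numerator by one and still stay above [a]; the
   [.+2] also keeps [p] positive. *)
pose j := (Num.bound (s0%:R - a * r0%:R)^-1).+2.
have jd : 1 < j%:R * (s0%:R - a * r0%:R).
  rewrite -ltr_pdivrMr// div1r (lt_trans (archi_boundP _)) ?invr_ge0 ?(ltW d0)//.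
  by rewrite ltr_nat.
pose p := (s0 * j).-1; pose q := (r0 * j)%N.
have pE : (p.+1 = s0 * j)%N by rewrite prednK// muln_gt0 s00.
have p0 : (0 < p)%N by rewrite -ltnS pE; rewrite /j; lia.
have q0 : (0 < q)%N by rewrite muln_gt0 r00.
have apq : a < p%:R / q%:R.
  rewrite ltr_pdivlMr ?ltr0n// -(ltrD2r 1) natr1 pE /q !natrM; nra.
have pq : (p * r0 < s0 * q)%N by rewrite /q mulnA mulnAC -pE mulSn -ltn_psubLR ?subnn; lia.
(* Otherwise [p / q] would be one of the ratios bounded by rho_a. *)
have often t0 : exists2 t, (t0 <= t)%N & symbolic_pow I (p * t) `<=` ideal_pow I (q * t).
  apply: contrapT => nt; have : ((p%:R / q%:R)%:E <= asymptotic_resurgence R I)%E.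
    apply: ereal_sup_ubound; exists p, q; split=> //; exists t0 => t t0t ht.
    by apply: nt; exists t.
  by rewrite rho_a_eq lee_fin leNgt apq.
have [B BP] := noncontainment_bounded I_homogeneous p0 q0 r00 pq often.
have [s0B r0B] := BP _ _ s00 (leqnn _) ns0.
pose P (x : 'I_B * 'I_B) := `[< [/\ (0 < x.1)%N, (0 < x.2)%N, (s0 * x.2 <= x.1 * r0)%N &
  ~ (symbolic_pow I x.1 `<=` ideal_pow I x.2)] >].
pose v (x : 'I_B * 'I_B) : R := x.1%:R / x.2%:R.
have P0 : P (Ordinal s0B, Ordinal r0B) by apply/asboolP.
case: (@Order.TotalTheory.arg_maxP _ _ _ _ P v P0) => -[s r] /asboolP[/= s_gt0 r_gt0 _ nsr] vmax.
(* A single pair of largest ratio in the box suffices. Noncontainments outside the box have ratio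
   below [s0 / r0], hence below this maximum. *)
exists [fset (val s, val r)]%fset; split.
- by move=> /fsetP/(_ (val s, val r)); rewrite !inE eqxx.
- by move=> s' r'; rewrite inE => /eqP[-> ->].
rewrite big_seq_fset1; apply/eqP; rewrite eq_le; apply/andP; split.
  apply: ge_ereal_sup => _ [m [m' [m0 m'0 nm ->]]]; rewrite lee_fin.
  have [sm|ms] := leqP (s0 * m') (m * r0).
    have [mB m'B] := BP _ _ m0 sm nm.
    by apply: (vmax (Ordinal mB, Ordinal m'B)); apply/asboolP.
  apply: le_trans (vmax _ P0); rewrite /v/= ler_pdivrMr ?ltr0n// mulrAC ler_pdivlMr//.
  by rewrite -!natrM ler_nat ltnW.
by apply: ereal_sup_ubound; exists s, r.
Qed.
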